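(* For every positive integer $n$ let $$\Pi_n=\{(i,j): i,j\ge1,\ i+j\le n,\ i\ne j\}\cup\{(i,n-i+1): i\ge 1,\ 2i\le n\}.$$ Then $\langle\chi_{\Pi_n},\chi_n\rangle=n!!$.
   Context: For a finite set $I$ of pairs of positive integers put $\chi_I=\prod_{(i,j)\in I}(x_i-x_j)$, and $\chi_n=\prod_{1\le i<j\le n}(x_i-x_j)$ (empty products are 1). $\langle\cdot,\cdot\rangle$ is the inner product on the real polynomial ring $\mathbf{R}[x_1,x_2,\dots]$ for which the monomials form an orthonormal basis. $n!!$ is the double factorial $n(n-2)(n-4)\cdots$, ending in $1$ or $2$. *)

(* Defs.v *)
From mathcomp Require Import all_boot all_order all_algebra.
From mathcomp Require Import finmap.
From mathcomp.multinomials Require Import monalg.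

Set Implicit Arguments.
Unset Strict Implicit.
Unset Printing Implicit Defensive.

Import GRing.Theory.

Local Open Scope fset_scope.
Local Open Scope ring_scope.

(* Finitely supported exponent families over nat, so that infinitely many
   variables are available.  There is also a variable of index 0; it occurs in
   none of the polynomials below, whose index pairs are positive. *)
Definition xpoly (R : comNzRingType) := {malg R[{cmonom nat}]}.

Definition xvar (R : comNzRingType) (i : nat) : xpoly R := << ucm i >>.

(* The supports are finite, so summing over that of f is enough. *)
Definition dotp (K : choiceType) (R : nzRingType) (f g : {malg R[K]}) : R :=
  \sum_(m <- msupp f) f@_m * g@_m.

Definition chi (R : comNzRingType) (I : {fset nat * nat}) : xpoly R :=
  \prod_(p <- I) (xvar R p.1 - xvar R p.2).

Definition upper_pairs (n : nat) : {fset nat * nat} :=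
  [fset ((i, j) : nat * nat) | i in iota 1 n, j in iota 1 n & (i < j)%N].

Definition chi_n (R : comNzRingType) (n : nat) : xpoly R := chi R (upper_pairs n).

(* The membership in iota 1 n only makes the comprehensions finite; see
   in_Pi_set. *)
Definition Pi_set (n : nat) : {fset nat * nat} :=
  [fset ((i, j) : nat * nat) | i in iota 1 n, j in iota 1 n
     & (i + j <= n)%N && (i != j)]
  `|` [fset ((i, n - i + 1)%N : nat * nat) | i in iota 1 n & (2 * i <= n)%N].

Fixpoint double_fact (n : nat) : nat :=
  if n is m.+2 then n * double_fact m else 1.

Lemma in_upper_pairs (n i j : nat) :
  ((i, j) \in upper_pairs n) = [&& 1 <= i, i < j & j <= n]%N.
Proof.
apply/imfset2P/idP => [[a] | /and3P[i1 ij jn]].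
  rewrite mem_iota => /andP[a1 an] [b]; rewrite !inE /= mem_iota.
  case/andP=> /andP[b1 bn] ab [-> ->]; rewrite a1 ab /=.
  by move: bn; rewrite add1n ltnS.
have j1 := leq_trans i1 (ltnW ij); have iN := leq_trans (ltnW ij) jn.
exists i; first by rewrite mem_iota i1 add1n ltnS iN.
by exists j; rewrite // !inE /= mem_iota j1 add1n ltnS jn ij.
Qed.

Lemma in_Pi_set (n i j : nat) :
  ((i, j) \in Pi_set n) =
  [&& 1 <= i, 1 <= j, i + j <= n & i != j]%N
  || [&& 1 <= i, 2 * i <= n & j == n - i + 1]%N.
Proof.
rewrite /Pi_set in_fsetU; congr orb.
  apply/imfset2P/idP => [[a] | /and4P[i1 j1 ijn ij]].
    rewrite mem_iota => /andP[a1 _] [b]; rewrite !inE /= mem_iota.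
    by case/andP=> /andP[b1 _] /andP[abn ab] [-> ->]; rewrite a1 b1 abn ab.
  exists i.
    by rewrite mem_iota i1 add1n ltnS (leq_trans (leq_addr j i) ijn).
  exists j; rewrite // !inE /= mem_iota j1 add1n ltnS ijn ij.
  by rewrite (leq_trans (leq_addl i j) ijn).
apply/imfsetP/idP => [[a] | /and3P[i1 i2n /eqP ->]].
  rewrite !inE /= mem_iota => /andP[/andP[a1 _] a2n] [-> ->].
  by rewrite a1 a2n eqxx.
exists i; rewrite // !inE /= mem_iota i1 i2n add1n ltnS.
by rewrite (leq_trans _ i2n) // leq_pmull.
Qed.

Lemma dotp_monomial (K : monomType) (R : nzRingType) (m1 m2 : K) :
  dotp (<< m1 >> : {malg R[K]}) (<< m2 >> : {malg R[K]}) = (m1 == m2)%:R.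
Proof.
by rewrite /dotp msuppU1 big_seq_fset1 !mcoeffU1 eqxx mul1r eq_sym.
Qed.

(* Main.v *)
(* Divide chi_Pi_n by the Vandermonde product chi_n.  For indeterminates a, b and
   a list s of length n - 2, the quotient at (a, s, b) is the quotient for n - 2
   at s times prod_(y in s) (y - a) / (y - b).  Summed over b in u, the set of all
   variables except a, these factors give 1: this is Lagrange interpolation of the
   constant 1 at the nodes u, evaluated at a.  The n choices of a therefore show
   that the sum of the quotient over all orderings of the variables is n!!.
   Since chi_n is antisymmetric, the antisymmetrization of chi_Pi_n equals
   n!! chi_n, and the coefficient of a single staircase monomial in this identity
   is the inner product, up to the same sign on both sides. *)

Require Import Defs.
From mathcomp Require Import all_boot all_order all_algebra all_fingroup.
From mathcomp Require Import finmap reals zify ring.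
From mathcomp.multinomials Require Import monalg.
From mathcomp.multinomials Require Import mpoly.

Set Implicit Arguments.
Unset Strict Implicit.
Unset Printing Implicit Defensive.

Import GRing.Theory.

Local Open Scope ring_scope.

(** * Lagrange interpolation of the constant 1 *)

(** As a polynomial in [a], the sum minus 1 has degree below [size u] and vanishes at every node of
    [u], so it is zero. *)
Lemma sum_lagrange_basis (K : fieldType) (u : seq K) (a : K) :
  uniq u -> u != [::] ->
  \sum_(b <- u) \prod_(y <- rem b u) ((y - a) / (y - b)) = 1.
Proof.
move=> Uu u_neq0.
pose l b : {poly K} := \prod_(y <- rem b u) ((y - b)^-1 *: (y%:P - 'X)).
have lE b z : (l b).[z] = \prod_(y <- rem b u) ((y - z) / (y - b)).
  by rewrite horner_prod; apply: eq_bigr => y _; rewrite !hornerE mulrC.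
have size_l b : b \in u -> (size (l b) <= size u)%N.
  move=> bu; have -> : size u = (size (rem b u)).+1.
    by rewrite size_rem // prednK //; case: (u) bu.
  rewrite /l; elim: (rem b u) => [|y v IHv]; first by rewrite big_nil size_poly1.
  rewrite big_cons; apply: leq_trans (size_polyMleq _ _) _.
  have size_y : (size ((y - b)^-1 *: (y%:P - 'X)) <= 2)%N.
    apply: leq_trans (size_scale_leq _ _) _.
    by rewrite -size_polyN opprB size_XsubC.
  by rewrite -subn1 leq_subLR; apply: leq_add size_y IHv.
pose q : {poly K} := \sum_(b <- u) l b - 1.
have qE z : q.[z] = \sum_(b <- u) \prod_(y <- rem b u) ((y - z) / (y - b)) - 1.
  by rewrite !hornerE horner_sum; under eq_bigr do rewrite lE.
suff q0 : q = 0 by apply/eqP; rewrite -subr_eq0 -qE q0 horner0.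
have size_q : (size q <= size u)%N.
  apply: leq_trans (size_polyD _ _) _; rewrite geq_max size_polyN size_poly1.
  rewrite lt0n size_eq0 u_neq0 andbT.
  apply: leq_trans (size_sum _ _ _) _; rewrite big_seq.
  by elim/big_ind: _ => [|m1 m2|b] //; [rewrite geq_max => -> | apply: size_l].
apply: (roots_geq_poly_eq0 _ Uu size_q).
apply/allP => z zu; rewrite rootE qE subr_eq0.
(* At a node [z], the term [b = z] has all factors 1; every other term contains the factor [y = z],
   which is 0. *)
rewrite (bigD1_seq z) //= [X in X + _]big_seq big1 => [|y]; last first.
  by rewrite mem_rem_uniq // inE => /andP[yz _]; rewrite divff // subr_eq0.
rewrite big_seq_cond big1 ?addr0 // => b /andP[bu bz].
rewrite (big_rem z) /= ?subrr ?mul0r //.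
by rewrite mem_rem_uniq // inE zu eq_sym bz.
Qed.

(** * Recursion for the quotient, removing the first and last entries *)

(* [Pi_set n] with indices starting at 0, the condition on [i + j] shifting by 2. *)
Definition Pi_rel (n i j : nat) : bool :=
  ((i + j).+1 < n)%N && (i != j) || (i < j)%N && ((i + j).+1 == n).

Definition diff_prod (S : comPzRingType) (n : nat) (r : rel nat) (x : 'I_n -> S) : S :=
  \prod_(i < n) \prod_(j < n | r i j) (x i - x j).

(** Index 0 is related to every other index, and [n.+1] to none. An inner index is related to 0 but
    not to [n.+1]. Between inner indices, lowering both by 1 lowers the bound by 2, leaving
    [Pi_rel n]. *)
Lemma diff_prod_Pi_rec (S : comPzRingType) n (x : nat -> S) :
  diff_prod (Pi_rel n.+2) (fun i : 'I_n.+2 => x i) =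
  (\prod_(i < n) (x 0%N - x i.+1)) * (x 0%N - x n.+1) *
  (\prod_(i < n) (x i.+1 - x 0%N)) * diff_prod (Pi_rel n) (fun i : 'I_n => x i.+1).
Proof.
rewrite /diff_prod big_ord_recl big_ord_recr /=.
rewrite [X in _ * (_ * X) = _]big1 ?mulr1; last first.
  by move=> j h; exfalso; move: h; rewrite /Pi_rel /bump /=; lia.
have first_row i : (i < n.+1)%N -> Pi_rel n.+2 0 i.+1 by rewrite /Pi_rel; lia.
rewrite big_mkcond big_ord_recl big_ord_recr /= mul1r first_row //.
rewrite -!mulrA; congr (_ * (_ * _)).
  by apply: eq_bigr => j _; rewrite first_row // ltnS ltnW.
rewrite -big_split /=; apply: eq_bigr => i _.
rewrite big_mkcond big_ord_recl big_ord_recr /= /bump /= !add1n.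
have -> : Pi_rel n.+2 i.+1 0 by rewrite /Pi_rel; have := ltn_ord i; lia.
have -> : Pi_rel n.+2 i.+1 n.+1 = false by rewrite /Pi_rel; lia.
rewrite mulr1 [in RHS]big_mkcond /=; congr (_ * _); apply: eq_bigr => j _.
by rewrite !add1n (_ : Pi_rel n.+2 i.+1 j.+1 = Pi_rel n i j) // /Pi_rel; lia.
Qed.

Lemma diff_prod_lt_rec (S : comPzRingType) n (x : nat -> S) :
  diff_prod ltn (fun i : 'I_n.+2 => x i) =
  (\prod_(i < n) (x 0%N - x i.+1)) * (x 0%N - x n.+1) *
  (\prod_(i < n) (x i.+1 - x n.+1)) * diff_prod ltn (fun i : 'I_n => x i.+1).
Proof.
rewrite /diff_prod big_ord_recl big_ord_recr /=.
rewrite [X in _ * (_ * X) = _]big1 ?mulr1; last first.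
  by move=> j h; exfalso; move: h (ltn_ord j); rewrite /bump /=; lia.
rewrite big_mkcond big_ord_recl big_ord_recr /= mul1r.
rewrite -!mulrA; congr (_ * (_ * _)).
rewrite -big_split /=; apply: eq_bigr => i _.
rewrite big_mkcond big_ord_recl big_ord_recr /= /bump /= !add1n mul1r mulrC.
rewrite ltnS ltn_ord [in RHS]big_mkcond /=; congr (_ * _).
Qed.

Lemma eq_diff_prod (S : comPzRingType) n (r : rel nat) (x y : 'I_n -> S) :
  x =1 y -> diff_prod r x = diff_prod r y.
Proof. by move=> xy; apply: eq_bigr => i _; apply: eq_bigr => j _; rewrite !xy. Qed.

Definition ratio (K : fieldType) (s : seq K) : K :=
  diff_prod (Pi_rel (size s)) (fun i : 'I_(size s) => s`_i)
  / diff_prod ltn (fun i : 'I_(size s) => s`_i).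

Lemma ratio_rec (K : fieldType) (a b : K) (s : seq K) :
  uniq (a :: rcons s b) ->
  ratio (a :: rcons s b) = (\prod_(y <- s) ((y - a) / (y - b))) * ratio s.
Proof.
move=> U; rewrite /ratio; set x := nth 0 (a :: _).
rewrite /= size_rcons (diff_prod_Pi_rec _ x) (diff_prod_lt_rec _ x).
have tl (i : 'I_(size s)) : x i.+1 = s`_i by rewrite /x /= nth_rcons ltn_ord.
have xl : x (size s).+1 = b by rewrite /x /= nth_rcons ltnn eqxx.
rewrite !(eq_diff_prod _ tl) xl /=.
have big_tl (F : K -> K) : \prod_(i < size s) F (x i.+1) = \prod_(y <- s) F y.
  by rewrite (big_nth 0) big_mkord; apply: eq_bigr => i _; rewrite tl.
rewrite (big_tl (fun z => a - z)) (big_tl (fun z => z - a)) (big_tl (fun z => z - b)).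
rewrite -/(ratio s) big_split prodfV /=.
move: U; rewrite /= mem_rcons inE => /andP[/norP[ab a_s] _].
have a_s0 : \prod_(y <- s) (a - y) != 0.
  rewrite prodf_seq_neq0; apply/allP => y ys /=; rewrite subr_eq0.
  by apply: contraNneq a_s => ->.
have ab0 : a - b != 0 by rewrite subr_eq0.
(* Only the products of [a - y] and [a - b] cancel; the other inverses are made opaque, so [field]
   asks nothing of them. *)
rewrite /ratio !invfM; set V := (diff_prod ltn _)^-1.
set W := diff_prod _ _.
set p := \prod_(y <- s) (a - y); set q := \prod_(y <- s) (y - a).
set q' := (\prod_(y <- s) (y - b))^-1.
by field; rewrite ab0.
Qed.

(** * Summing the quotient over all orderings *)

Lemma sum_permutations_first (V : nmodType) (T : eqType) (F : seq T -> V) (s : seq T) :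
  uniq s -> s != [::] ->
  \sum_(t <- permutations s) F t =
  \sum_(a <- s) \sum_(t <- permutations (rem a s)) F (a :: t).
Proof.
move=> Us s0; rewrite (perm_big _ (permutationsE _)) /=; last by case: (s) s0.
by rewrite undup_id // big_allpairs_dep.
Qed.

Lemma sum_permutations_last (V : nmodType) (T : eqType) (F : seq T -> V) (s : seq T) :
  uniq s -> s != [::] ->
  \sum_(t <- permutations s) F t =
  \sum_(b <- s) \sum_(t <- permutations (rem b s)) F (rcons t b).
Proof.
have sum_rev (G : seq T -> V) u :
    \sum_(t <- permutations u) G t = \sum_(t <- permutations u) G (rev t).
  rewrite -(big_map rev xpredT); apply/perm_big/uniq_perm.
  - exact: permutations_uniq.
  - by rewrite map_inj_uniq ?permutations_uniq //; apply/inv_inj/revK.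
  move=> t; apply/idP/mapP => [tu|[v vu ->]]; last first.
    by move: vu; rewrite !mem_permutations perm_rev.
  exists (rev t); last by rewrite revK.
  by move: tu; rewrite !mem_permutations perm_rev.
move=> Us s0; rewrite sum_rev sum_permutations_first //.
apply: eq_bigr => b _; rewrite [RHS]sum_rev; apply: eq_bigr => t _.
by rewrite rev_cons.
Qed.

Lemma sum_ratio (K : fieldType) (s : seq K) :
  uniq s -> \sum_(t <- permutations s) ratio t = (double_fact (size s))%:R.
Proof.
have [m] := ubnP (size s); elim: m => // m IHm in s *.
case: s => [|a [|b s]] lt_sm Us.
- by rewrite big_seq1 /ratio /diff_prod /= !big_ord0 divr1.
- by rewrite big_seq1 /ratio /diff_prod /= !big_ord1 !big1 ?divr1 // => -[[]].
set u := [:: a, b & s] in lt_sm Us *.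
have -> : double_fact (size u) = (size u * double_fact (size s))%N by [].
(* The factor [size u] becomes a sum of ones over the first entry [c], so it suffices to compare
   terms. *)
rewrite natrM -sum1_size natr_sum mulr_suml sum_permutations_first //.
apply: eq_big_seq => c cu; rewrite mul1r.
have Uc : uniq (rem c u) by rewrite rem_uniq.
have sz_c : size (rem c u) = (size s).+1 by rewrite size_rem.
have c0 : rem c u != [::] by rewrite -size_eq0 sz_c.
rewrite sum_permutations_last //; set D := _%:R.
(* The 1 is expanded as the Lagrange sum at [c] over the last entry [d], to match the left side term
   by term. *)
rewrite -[RHS]mul1r -(sum_lagrange_basis c Uc c0) mulr_suml.
apply: eq_big_seq => d du.
have sz_d : size (rem d (rem c u)) = size s by rewrite size_rem ?sz_c.
rewrite /D -sz_d -IHm ?rem_uniq //; last by rewrite sz_d; apply: ltnW; rewrite -ltnS.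
rewrite mulr_sumr; apply: eq_big_seq => t; rewrite mem_permutations => t_perm.
rewrite ratio_rec ?(perm_big _ t_perm) //.
rewrite (perm_uniq (_ : perm_eq _ u)) // perm_sym.
apply: perm_trans (perm_to_rem cu) _; rewrite perm_cons.
apply: perm_trans (perm_to_rem du) _.
by rewrite perm_sym perm_rcons perm_cons.
Qed.

(** Passes from list orderings to the symmetric group, where signs are available. The map [G] is
    injective and both sides have n! elements, so it is onto. *)
Lemma sum_permutations_ord (V : nmodType) (T : eqType) n (F : seq T -> V) (x : 'I_n -> T) :
  injective x ->
  \sum_(t <- permutations [seq x i | i <- enum 'I_n]) F t =
  \sum_(s : 'S_n) F [seq x (s i) | i <- enum 'I_n].
Proof.
move=> x_inj; pose G (s : 'S_n) := [seq x (s i) | i <- enum 'I_n].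
have G_inj : injective G.
  move=> s1 s2 /eq_in_map eq12; apply/permP => i.
  by apply/x_inj/eq12; rewrite mem_enum.
have Ux : uniq [seq x i | i <- enum 'I_n] by rewrite map_inj_uniq ?enum_uniq.
rewrite -[RHS](big_map G xpredT); apply/perm_big; rewrite perm_sym.
have UG : uniq (map G (index_enum 'S_n)).
  by rewrite map_inj_uniq // /index_enum -enumT enum_uniq.
have sub_perm : {subset map G (index_enum 'S_n)
                 <= permutations [seq x i | i <- enum 'I_n]}.
  move=> _ /mapP[s _ ->]; rewrite mem_permutations /G map_comp.
  have Us : uniq [seq s i | i <- enum 'I_n].
    by rewrite map_inj_uniq ?enum_uniq //; apply: perm_inj.
  apply/perm_map/uniq_perm; rewrite ?enum_uniq //.
  move=> i; rewrite mem_enum; apply/mapP; exists (s^-1%g i); rewrite ?mem_enum //.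
  by rewrite permKV.
apply: uniq_perm; rewrite ?permutations_uniq //.
apply: (uniq_min_size UG sub_perm _).2.
rewrite size_permutations // !size_map -enumT size_enum_ord.
by rewrite -(card_Sn n) cardE enumT /index_enum unlock.
Qed.

(** * Antisymmetrization of the product over [Pi_rel] *)

Lemma rmorph_diff_prod (S S' : comPzRingType) (f : {rmorphism S -> S'}) n (r : rel nat)
    (x : 'I_n -> S) :
  f (diff_prod r x) = diff_prod r (fun i => f (x i)).
Proof.
rewrite /diff_prod rmorph_prod; apply: eq_bigr => i _.
by rewrite rmorph_prod; apply: eq_bigr => j _; rewrite rmorphB.
Qed.

Lemma ratio_map (K : fieldType) n (y : 'I_n -> K) :
  ratio [seq y i | i <- enum 'I_n] = diff_prod (Pi_rel n) y / diff_prod ltn y.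
Proof.
rewrite /ratio; set t := map _ _.
have tE (i : 'I_n) : t`_i = y i by rewrite (nth_map i) ?size_enum_ord // nth_ord_enum.
have -> : size t = n by rewrite size_map size_enum_ord.
by rewrite !(eq_diff_prod _ tE).
Qed.

(* The exponent of the sign of the order-reversing permutation, which separates
   [chi_n] from the Vandermonde determinant of [det_Vandermonde]. *)
Definition inversions (n : nat) : nat := (\sum_(i < n) #|[pred j : 'I_n | i < j]|)%N.

(** The Leibniz expansion of the Vandermonde determinant, whose factors [x j - x i] are all reversed
    here. *)
Lemma diff_prod_ltE (S : comPzRingType) n (x : 'I_n -> S) :
  diff_prod ltn x =
  (-1) ^+ inversions n * \sum_(s : 'S_n) (-1) ^+ s * \prod_(i < n) x (s i) ^+ i.
Proof.
have -> : \sum_(s : 'S_n) (-1) ^+ s * \prod_(i < n) x (s i) ^+ i =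
    \det (Vandermonde n (\row_i x i)).
  apply: eq_bigr => s _; congr (_ * _); apply: eq_bigr => i _.
  by rewrite !mxE.
rewrite det_Vandermonde /inversions -prodrXr -big_split.
apply: eq_bigr => i _ /=; rewrite -prodrN.
by apply: eq_bigr => j _; rewrite !mxE opprB.
Qed.

Lemma diff_prod_lt_perm (S : comPzRingType) n (x : 'I_n -> S) (s : 'S_n) :
  diff_prod ltn (fun i => x (s i)) = (-1) ^+ s * diff_prod ltn x.
Proof.
rewrite !diff_prod_ltE mulrCA; congr (_ * _).
rewrite mulr_sumr [RHS](reindex_inj (mulIg s)) /=; apply: eq_bigr => t _.
rewrite odd_permM signr_addb [X in _ = _ * (X * _)]mulrC !mulrA -expr2 sqrr_sign mul1r.
by congr (_ * _); apply: eq_bigr => i _; rewrite permM.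
Qed.

Lemma diff_prod_lt_neq0 (D : idomainType) n (x : 'I_n -> D) :
  injective x -> diff_prod ltn x != 0.
Proof.
move=> x_inj; apply/prodf_neq0 => i _; apply/prodf_neq0 => j ij.
by rewrite subr_eq0 (inj_eq x_inj) -val_eqE ltn_eqF.
Qed.

(** This is [sum_ratio] multiplied by the Vandermonde product; the signs come from its
    antisymmetry. *)
Lemma antisym_diff_prod_Pi_field (K : fieldType) n (x : 'I_n -> K) :
  injective x ->
  \sum_(s : 'S_n) (-1) ^+ s * diff_prod (Pi_rel n) (fun i => x (s i)) =
  (double_fact n)%:R * diff_prod ltn x.
Proof.
move=> x_inj; have x0 := diff_prod_lt_neq0 x_inj.
have Ux : uniq [seq x i | i <- enum 'I_n] by rewrite map_inj_uniq ?enum_uniq.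
have := sum_ratio Ux; rewrite size_map size_enum_ord => <-.
rewrite sum_permutations_ord // mulr_suml; apply: eq_bigr => s _.
rewrite ratio_map diff_prod_lt_perm invfM -mulrA mulfVK //.
by rewrite invr_sign mulrC.
Qed.

(** The identity is checked in the fraction field, where the quotients exist, so that it applies to
    polynomial variables. *)
Lemma antisym_diff_prod_Pi (D : idomainType) n (x : 'I_n -> D) :
  injective x ->
  \sum_(s : 'S_n) (-1) ^+ s * diff_prod (Pi_rel n) (fun i => x (s i)) =
  (double_fact n)%:R * diff_prod ltn x.
Proof.
move=> x_inj.
have tofrac_inj : injective (@tofrac D) by move=> u v /eqP; rewrite tofrac_eq => /eqP.
apply: (tofrac_inj).
rewrite rmorphM rmorph_nat rmorph_diff_prod rmorph_sum /=.
rewrite -antisym_diff_prod_Pi_field; last first.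
  by move=> i j /tofrac_inj/x_inj.
by apply: eq_bigr => s _; rewrite rmorphM rmorph_sign rmorph_diff_prod.
Qed.

(** * Coefficients at permuted staircase monomials *)

Local Notation "m # s" := [multinom m (s i) | i < _] (at level 40, left associativity).

Definition staircase n : multinom n := [multinom (i : nat) | i < n].

(* [mpoly n R] is spelled out since [{mpoly R[n]}] is [monalg]'s notation here. *)
Lemma diff_prod_lt_mpolyX (R : comNzRingType) n :
  diff_prod ltn (fun i : 'I_n => 'X_i : mpoly n R) =
  (-1) ^+ inversions n * \sum_(s : 'S_n) (-1) ^+ s * 'X_[staircase n # s].
Proof.
(* Inverting [s] moves the permutation from the variables to the exponents without changing its
   sign. *)
rewrite diff_prod_ltE (reindex_inj invg_inj) /=; congr (_ * _).
apply: eq_bigr => s _; rewrite odd_permV mpolyXE_id; congr (_ * _).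
rewrite [RHS](reindex_inj (@perm_inj _ s^-1%g)) /=.
by apply: eq_bigr => i _; rewrite !mnmE permKV.
Qed.

Lemma msym_diff_prod (R : comNzRingType) n (r : rel nat) (s : 'S_n) :
  msym s (diff_prod r (fun i : 'I_n => 'X_i : mpoly n R)) =
  diff_prod r (fun i : 'I_n => 'X_(s i)).
Proof.
rewrite rmorph_diff_prod; apply: eq_diff_prod => i.
rewrite /= msymX; congr 'X_[_]; apply/mnmP => j.
by rewrite mnmE !mnm1E -(inj_eq (@perm_inj _ s)) permKV.
Qed.

Lemma staircase_perm_eq n (s : 'S_n) : (staircase n # s == staircase n) = (s == 1%g).
Proof.
apply/eqP/eqP => [/mnmP eq_s | ->]; last by apply/mnmP => i; rewrite !mnmE perm1.
by apply/permP => i; apply/val_inj; move: (eq_s i); rewrite !mnmE perm1.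
Qed.

Lemma mcoeff_signM (R : nzRingType) n (k : nat) (p : mpoly n R) m :
  ((-1) ^+ k * p)@_m = (-1) ^+ k * p@_m.
Proof.
by rewrite -!(signr_odd _ k); case: odd; rewrite ?expr1 ?mulN1r ?mcoeffN ?expr0 ?mul1r.
Qed.

Lemma mcoeff_diff_prod_lt (R : comNzRingType) n :
  (diff_prod ltn (fun i : 'I_n => 'X_i : mpoly n R))@_(staircase n) =
  (-1) ^+ inversions n.
Proof.
rewrite diff_prod_lt_mpolyX mcoeff_signM raddf_sum (bigD1 1%g) //= big1 => [|s s1].
  by rewrite mcoeff_signM mcoeffX staircase_perm_eq eqxx odd_perm1 addr0 !mulr1.
by rewrite mcoeff_signM mcoeffX staircase_perm_eq (negbTE s1) mulr0.
Qed.

(** The staircase coefficient of the antisymmetrization identity. Permuting variables in a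
    polynomial amounts to permuting the monomial at which its coefficient is read. *)
Lemma sum_mcoeff_diff_prod_Pi (R : idomainType) n :
  (-1) ^+ inversions n * \sum_(s : 'S_n)
    (-1) ^+ s * (diff_prod (Pi_rel n) (fun i : 'I_n => 'X_i : mpoly n R))@_(staircase n # s)
  = (double_fact n)%:R.
Proof.
have X_inj : injective (fun i : 'I_n => 'X_i : mpoly n R).
  move=> i j /(congr1 (mcoeff U_(i)%MM)); rewrite !mcoeffXU eqxx.
  by case: eqP => // _ /eqP; rewrite oner_eq0.
have /(congr1 (mcoeff (staircase n))) := antisym_diff_prod_Pi X_inj.
rewrite mulr_natl mcoeffMn mcoeff_diff_prod_lt raddf_sum /=.
under eq_bigr do rewrite mcoeff_signM -msym_diff_prod mcoeff_sym.
by move=> ->; rewrite mulrnAr -expr2 sqrr_sign.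
Qed.

(** * Transfer to infinitely many variables *)

(* The 0-indexed variable ['X_i] of [mpoly n R] corresponds to [xvar R i.+1]. *)
Definition xmonom n (m : multinom n) : {cmonom nat} :=
  \big[mmul/mone]_(i < n) \big[mmul/mone]_(j < m i) ucm i.+1.

Lemma cm_prod (K : choiceType) (J : finType) (F : J -> {cmonom K}) (k : K) :
  (\big[mmul/mone]_j F j) k = (\sum_j F j k)%N.
Proof. exact: (big_morph (fun u : {cmonom K} => u k) (cmM k) (cm1 k)). Qed.

Lemma xmonom_inj n : injective (@xmonom n).
Proof.
have xmonomE (m : multinom n) (i : 'I_n) : xmonom m i.+1 = m i.
  apply: etrans (cm_prod _ _) _; rewrite (bigD1 i) //= [X in (_ + X)%N]big1 => [|k ki].
    rewrite addn0; apply: etrans (cm_prod _ _) _.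
    by under eq_bigr do rewrite cmUU; rewrite sum1_card card_ord.
  apply: etrans (cm_prod _ _) _.
  by rewrite big1 // => l _; rewrite cmU eqSS val_eqE (negbTE ki).
by move=> m1 m2 eq_m; apply/mnmP => i; rewrite -!xmonomE eq_m.
Qed.

Definition to_xpoly (R : comNzRingType) n : mpoly n R -> xpoly R :=
  mpoly.mmap (@malgC {cmonom nat} R) (fun i : 'I_n => xvar R i.+1).

Lemma malgU_mul (K : monomType) (R : nzRingType) (m1 m2 : K) :
  << mmul m1 m2 >> = << m1 >> * << m2 >> :> {malg R[K]}.
Proof. by rewrite malgM_def fgmulUU mulr1. Qed.

Lemma mmap1_xvar (R : comNzRingType) n (m : multinom n) :
  mmap1 (fun i : 'I_n => xvar R i.+1) m = << xmonom m >>.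
Proof.
rewrite /mmap1 /xmonom (big_morph _ (@malgU_mul _ R) (erefl : << mone >> = 1)).
apply: eq_bigr => i _.
by rewrite (big_morph _ (@malgU_mul _ R) (erefl : << mone >> = 1)) prodr_const card_ord.
Qed.

(** By injectivity of [xmonom], distinct monomials do not merge. *)
Lemma mcoeff_to_xpoly (R : comNzRingType) n (p : mpoly n R) (m : multinom n) :
  monalg.mcoeff (xmonom m) (to_xpoly p) = p@_m.
Proof.
rewrite [in RHS](mpolyE p) /to_xpoly /mpoly.mmap !raddf_sum /=.
apply: eq_bigr => u _.
by rewrite mmap1_xvar monalg.mcoeffCM mcoeffZ mcoeffX mcoeffU1 (inj_eq (@xmonom_inj n)).
Qed.

Lemma malg_signM (K : monomType) (R : nzRingType) (k : nat) (c : R) (m : K) :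
  (-1) ^+ k * << c *g m >> = << (-1) ^+ k * c *g m >> :> {malg R[K]}.
Proof.
by rewrite -!(signr_odd _ k); case: odd; rewrite ?expr0 ?mul1r ?expr1 ?mulN1r ?monalgUN.
Qed.

Lemma dotp_suml (K : choiceType) (R : comNzRingType) (I : finType) (f : {malg R[K]})
    (c : I -> R) (m : I -> K) :
  dotp f (\sum_i << c i *g m i >>) = \sum_i c i * monalg.mcoeff (m i) f.
Proof.
rewrite /dotp; under eq_bigr do rewrite raddf_sum mulr_sumr.
rewrite exchange_big /=; apply: eq_bigr => i _.
(* Outside the support of [f] the coefficient is 0, and no term of the sum over that support meets
   [m i]. *)
have [m_f|m_f] := boolP (m i \in monalg.msupp f).
  rewrite (big_fsetD1 (m i)) //= mcoeffUU mulrC big1_fset ?addr0 // => k.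
  by rewrite in_fsetD1 mcoeffU eq_sym => /andP[/negbTE -> _] _; rewrite mulr0.
rewrite (mcoeff_outdom m_f) mulr0 big1_fset // => k kf _.
by rewrite mcoeffU; case: eqP kf m_f => [-> -> | _ _ _] //; rewrite mulr0.
Qed.

Lemma to_xpoly_mnm (R : comNzRingType) n (m : multinom n) :
  to_xpoly ('X_[m] : mpoly n R) = << xmonom m >>.
Proof. by rewrite -mmap1_xvar; apply: mmapX. Qed.

Lemma to_xpoly_diff_prod (R : comNzRingType) n (r : rel nat) :
  to_xpoly (diff_prod r (fun i : 'I_n => 'X_i : mpoly n R)) =
  diff_prod r (fun i : 'I_n => xvar R i.+1).
Proof.
rewrite /to_xpoly rmorph_diff_prod; apply: eq_diff_prod => i.
by apply: etrans (mmapX _ _ _) _; apply: mmap1U.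
Qed.

(** The shift [h] of both indices by 1 is a bijection from the pairs related by [r] onto [I]. *)
Lemma chi_to_xpoly (R : comNzRingType) n (I : {fset nat * nat}) (r : rel nat) :
  (forall i j, ((i, j) \in I) =
     [&& 0 < i, i <= n, 0 < j, j <= n & r i.-1 j.-1])%N ->
  chi R I = to_xpoly (diff_prod r (fun i : 'I_n => 'X_i : mpoly n R)).
Proof.
move=> in_I; rewrite to_xpoly_diff_prod /diff_prod pair_big_dep /=.
pose h (p : 'I_n * 'I_n) := (p.1.+1 : nat, p.2.+1 : nat).
rewrite -(big_map h (fun p => r p.1.-1 p.2.-1) (fun p => xvar R p.1 - xvar R p.2)).
rewrite -big_filter; apply/perm_big/uniq_perm.
- exact: fset_uniq.
- apply/filter_uniq; rewrite map_inj_uniq ?index_enum_uniq //.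
  by move=> [i j] [k l] [/val_inj -> /val_inj ->].
case=> i j; rewrite in_I mem_filter /=; apply/idP/andP.
  case/and5P=> i0 i_n j0 j_n rij; split=> //; apply/mapP.
  have lt_i : (i.-1 < n)%N by rewrite prednK.
  have lt_j : (j.-1 < n)%N by rewrite prednK.
  exists (Ordinal lt_i, Ordinal lt_j); first by rewrite mem_index_enum.
  by rewrite /h /= !prednK.
by case=> rij /mapP[[u v] _ [iE jE]]; move: rij; rewrite iE jE /= !ltn_ord => ->.
Qed.

Theorem proposition6p4 (R : realType) (n : nat) (hn : (0 < n)%N) :
  dotp (chi R (Pi_set n)) (chi_n R n) = ((double_fact n)%:R : R)%R.
Proof.
rewrite /chi_n (@chi_to_xpoly R n (upper_pairs n) ltn) => [|i j]; last first.
  by rewrite in_upper_pairs; lia.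
(* On the antidiagonal [i + j = n + 1], the condition [2 * i <= n] says exactly [i < j]. *)
rewrite (@chi_to_xpoly R n (Pi_set n) (Pi_rel n)) => [|i j]; last first.
  by rewrite in_Pi_set /Pi_rel; lia.
have -> : to_xpoly (diff_prod ltn (fun i : 'I_n => 'X_i : mpoly n R)) =
  \sum_(s : 'S_n) << (-1) ^+ inversions n * (-1) ^+ s *g xmonom (staircase n # s) >>.
  rewrite diff_prod_lt_mpolyX /to_xpoly rmorphM rmorph_sign rmorph_sum mulr_sumr /=.
  apply: eq_bigr => s _.
  rewrite rmorphM rmorph_sign /= -/(to_xpoly _) to_xpoly_mnm.
  by rewrite !malg_signM mulr1.
(* Pairing with the signed staircase monomials of [chi_n] yields the signed coefficient sum already
   evaluated. *)
rewrite dotp_suml -sum_mcoeff_diff_prod_Pi mulr_sumr; apply: eq_bigr => s _.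
by rewrite mcoeff_to_xpoly mulrA.
Qed.
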